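(* If $G$ is a connected regular nonbipartite graph of order $n$ and diameter $D$, then $$\mu(G)+\mu_{\min}(G)>\frac{2}{n(2D+1)}.$$
   Context: Graphs are finite, simple and undirected, with nonempty vertex set; the order of a graph is its number of vertices. $\mu(G)$ and $\mu_{\min}(G)$ denote the largest and the smallest eigenvalues of the adjacency matrix of $G$. The diameter is the maximum over pairs of vertices of the length of a shortest path joining them. *)

(* Defs.v *)
From HB Require Import structures.
From mathcomp Require Import all_boot all_order all_algebra.
From mathcomp Require Import boolp classical_sets reals.
From mathcomp Require Import complex polyrcf.

Set Implicit Arguments.
Unset Strict Implicit.
Unset Printing Implicit Defensive.

Import Order.TTheory GRing.Theory Num.Theory.
Local Open Scope ring_scope.

(* A graph is given by its adjacency relation e on its vertex type T; that e is
   symmetric and irreflexive (undirected, no loops) is assumed where needed. *)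
Section Graph.
Variables (T : finType) (e : rel T).

Definition connected_graph : Prop := forall x y : T, connect e x y.

Definition regular_graph : Prop :=
  exists k : nat, forall x : T, #|[set y | e x y]| = k.

Definition bipartite_graph : Prop :=
  exists A : {set T}, forall x y : T, e x y -> (x \in A) != (y \in A).

(* p does not include the initial vertex x, so its size is the number of edges. *)
Definition is_upath (x y : T) (p : seq T) : bool :=
  [&& path e x p, uniq (x :: p) & last x p == y].

(* Path lengths are < #|T|, so the search range is exhaustive; the value is the
   junk value #|T| when y is not reachable from x. *)
Definition gdist (x y : T) : nat :=
  find (fun k => [exists p : k.-tuple T, is_upath x y p]) (iota 0 #|T|).

Definition diameter : nat := (\max_(x : T) \max_(y : T) gdist x y)%N.

Lemma gdist_min x y p : is_upath x y p -> (gdist x y <= size p)%N.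
Proof.
move=> xyp; rewrite leqNgt; apply/negP => lt.
have h := before_find 0%N lt; rewrite nth_iota ?add0n in h; last first.
  by rewrite (leq_trans lt)// -[leqRHS](size_iota 0) find_size.
by move: h => /existsP; apply; exists (in_tuple p).
Qed.

Lemma gdist_path x y :
  connect e x y -> exists2 p, is_upath x y p & size p = gdist x y.
Proof.
case/connectP => p0 /shortenP[p ep up _] ->.
pose a k := [exists q : k.-tuple T, is_upath x (last x p) q].
have h : has a (iota 0 #|T|).
  apply/hasP; exists (size p).
    by rewrite mem_iota /= add0n; have := card_uniqP up => /= <-; exact: max_card.
  by apply/existsP; exists (in_tuple p); rewrite /is_upath ep up eqxx.
have := nth_find 0%N h; rewrite nth_iota; last first.
  by rewrite -{2}(size_iota 0 #|T|) -has_find.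
by case/existsP => q hq; exists q => //; rewrite size_tuple add0n.
Qed.

End Graph.

Definition adjacency (R : realType) (T : finType) (e : rel T) : 'M[R]_#|T| :=
  \matrix_(i, j) (e (enum_val i) (enum_val j))%:R.

(* The set of eigenvalues is finite, and nonempty when A is symmetric of positive
   size; sup and inf are then attained (max_eigenvalueP, min_eigenvalueP). *)
Definition max_eigenvalue (R : realType) (n : nat) (A : 'M[R]_n) : R :=
  sup [set a | eigenvalue A a]%classic.

Definition min_eigenvalue (R : realType) (n : nat) (A : 'M[R]_n) : R :=
  inf [set a | eigenvalue A a]%classic.

Definition mu_max (R : realType) (T : finType) (e : rel T) : R :=
  max_eigenvalue (adjacency R e).

Definition mu_min (R : realType) (T : finType) (e : rel T) : R :=
  min_eigenvalue (adjacency R e).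

Section SymmetricEigenvalues.
Variables (R : realType) (n : nat) (A : 'M[R]_n).
Hypotheses (n_gt0 : (0 < n)%N) (symA : A^T = A).

Lemma sym_eigenvalue_ex : exists a, eigenvalue A a.
Proof.
pose f : {rmorphism R -> R[i]} := real_complex R.
pose B := map_mx f A.
have [z rz] : exists z, root (char_poly B) z.
  apply: closed_rootP; rewrite size_char_poly; apply/eqP => -[E].
  by move: n_gt0; rewrite E.
have /eigenvalueP[v vB v0] : eigenvalue B z by rewrite eigenvalue_root_char.
pose w : 'cV_n := (map_mx Num.conj v)^T.
have Bc : map_mx Num.conj B = B.
  by apply/matrixP => i j; rewrite !mxE; apply: conjc_real.
have d : (v *m w) 0 0 = \sum_j `|v 0 j| ^+ 2.
  by rewrite mxE; apply: eq_bigr => k _; rewrite !mxE normCK.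
have s0 : \sum_j `|v 0 j| ^+ 2 != 0.
  apply: contraNneq v0 => /psumr_eq0P H; apply/eqP/rowP => j; rewrite mxE.
  have /eqP := H (fun k _ => exprn_ge0 _ (normr_ge0 _)) j isT.
  by rewrite sqrf_eq0 normr_eq0 => /eqP.
have e1 : v *m B *m w = z *: (v *m w) by rewrite vB scalemxAl.
have symB : B^T = B by rewrite matrix.map_trmx symA.
have e2 : v *m B *m w = z^* *: (v *m w).
  rewrite -mulmxA -{1}symB -{1}Bc -trmx_mul -map_mxM vB.
  by rewrite map_mxZ linearZ /= -scalemxAr.
have zz : z = z^*.
  have /matrixP/(_ 0 0) := etrans (esym e1) e2.
  by rewrite mxE [RHS]mxE d => /(mulIf s0).
have : z \is Num.real by rewrite CrealE -zz.
move/complex_realP => [a za]; exists a.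
by rewrite -(eigenvalue_map f) -[f a]za eigenvalue_root_char.
Qed.

Let p0 : char_poly A != 0. Proof. by rewrite monic_neq0 // char_poly_monic. Qed.

Let eigenvalueE a : eigenvalue A a = (a \in rootsR (char_poly A)).
Proof.
by rewrite eigenvalue_root_char -(roots_on_rootsR p0) in_itv.
Qed.

Lemma eigenvalue_max_ex :
  exists2 m, eigenvalue A m & forall a, eigenvalue A a -> a <= m.
Proof.
have [a ea] := sym_eigenvalue_ex.
have [s sE] : exists s : seq R, forall a, eigenvalue A a = (a \in s).
  by exists (rootsR (char_poly A)) => ?; rewrite eigenvalueE.
have as_ : a \in s by rewrite -sE.
pose i0 := Ordinal (etrans (index_mem a s) as_).
have [i _ im] := @Order.TotalTheory.arg_maxP _ _ 'I_(size s) i0 xpredT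
  (fun i => s`_i) isT.
exists s`_i; first by rewrite sE mem_nth.
move=> b; rewrite sE => bs; rewrite -(nth_index 0 bs).
exact: (im (Ordinal (etrans (index_mem b s) bs)) isT).
Qed.

Lemma eigenvalue_min_ex :
  exists2 m, eigenvalue A m & forall a, eigenvalue A a -> m <= a.
Proof.
have [a ea] := sym_eigenvalue_ex.
have [s sE] : exists s : seq R, forall a, eigenvalue A a = (a \in s).
  by exists (rootsR (char_poly A)) => ?; rewrite eigenvalueE.
have as_ : a \in s by rewrite -sE.
pose i0 := Ordinal (etrans (index_mem a s) as_).
have [i _ im] := @Order.TotalTheory.arg_minP _ _ 'I_(size s) i0 xpredT
  (fun i => s`_i) isT.
exists s`_i; first by rewrite sE mem_nth.
move=> b; rewrite sE => bs; rewrite -(nth_index 0 bs).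
exact: (im (Ordinal (etrans (index_mem b s) bs)) isT).
Qed.

Lemma max_eigenvalueP : eigenvalue A (max_eigenvalue A) /\
  forall a, eigenvalue A a -> a <= max_eigenvalue A.
Proof.
have [m em mub] := eigenvalue_max_ex.
suff -> : max_eigenvalue A = m by [].
apply/eqP; rewrite eq_le; apply/andP; split.
  by apply: ge_sup; [exists m | move=> a /mub].
by apply: ub_le_sup => //; exists m => a /mub.
Qed.

Lemma min_eigenvalueP : eigenvalue A (min_eigenvalue A) /\
  forall a, eigenvalue A a -> min_eigenvalue A <= a.
Proof.
have [m em mlb] := eigenvalue_min_ex.
suff -> : min_eigenvalue A = m by [].
apply/eqP; rewrite eq_le; apply/andP; split.
  by apply: ge_inf => //; exists m => a /mlb.
by apply: lb_le_inf; [exists m | move=> a /mlb].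
Qed.

End SymmetricEigenvalues.

Lemma adjacency_tr (R : realType) (T : finType) (e : rel T) :
  symmetric e -> (adjacency R e)^T = adjacency R e.
Proof. by move=> es; apply/matrixP => i j; rewrite !mxE es. Qed.

(* Main.v *)
Require Import Defs.
From mathcomp Require Import all_boot all_order all_algebra.
From mathcomp Require Import boolp classical_sets reals.
From mathcomp Require Import ring lra.

(**
Let k be the degree of the graph e, n the number of vertices and D the diameter.
The all-ones vector has eigenvalue k, so the largest eigenvalue is at least k,
and it is enough to bound k + a from below, where a is the smallest eigenvalue.
For an eigenvector x of a,
  (k + a) * sum_t (x t)^2 = sum over the edges st of (x s + x t)^2,
the quadratic form of the signless Laplacian ([signless_form_regular]).  It would
vanish only for an x that changes sign along every edge, which an odd closed walk
forbids; the proof makes this quantitative.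

Let u be a vertex where |x| is largest, so that n * (x u)^2 is at least
sum_t (x t)^2.  As the graph is not bipartite, some edge vw joins two vertices at
the same distance d <= D from u ([level_edge]).  Going from u to v along a
geodesic, across vw, and back along a geodesic from w is a closed walk of odd
length 2d + 1, and the alternating sum of the x s + x t along it is 2 (x u) up to
sign.  Hence 2 |x u| is at most the sum of |x s + x t| along the walk.  The two
geodesics may share edges, so only the one with the larger sum is kept: |x u| is
at most that sum plus |x v + x w| / 2.  This geodesic followed by vw is a simple
path ([geodesic_avoids]), its edges are distinct, and the Cauchy-Schwarz
inequality gives (x u)^2 <= (d + 1/4) * (k + a) * sum_t (x t)^2
([signless_form_lower_bound]).  Therefore
  k + a >= 4 / (n (4 D + 1)) > 4 / (n (4 D + 2)) = 2 / (n (2 D + 1)).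
The strictness comes from the edge vw, which the closed walk uses only once,
whereas the geodesic edges may be used twice.
*)

Set Implicit Arguments.
Unset Strict Implicit.
Unset Printing Implicit Defensive.

Import Order.TTheory GRing.Theory Num.Theory.
Local Open Scope ring_scope.

(** * Distances and edges inside a distance level *)

Section Distance.
Variables (T : finType) (e : rel T).

Lemma gdist_le_path u p : path e u p -> (gdist e u (last u p) <= size p)%N.
Proof.
move=> ep; case: (shortenP ep) => q eq uq /uniq_leq_size sub.
have uq' : uniq q by case/andP: uq.
apply: leq_trans (gdist_min _) (sub uq').
by rewrite /is_upath eq uq eqxx.
Qed.

Lemma gdist_edge u y z :
  connect e u y -> e y z -> (gdist e u z <= (gdist e u y).+1)%N.
Proof.
move=> /gdist_path[p /and3P[ep _ /eqP lp] <-] yz.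
have := @gdist_le_path u (rcons p z).
by rewrite rcons_path ep lp yz last_rcons size_rcons; apply.
Qed.

Lemma gdist_diameter x y : (gdist e x y <= diameter e)%N.
Proof.
apply: leq_trans (leq_bigmax (F := fun x => \max_y gdist e x y) x).
exact: (leq_bigmax (F := gdist e x)).
Qed.

(** Each vertex of a geodesic other than its end is strictly closer to u than the
end is, so a vertex at the same distance as the end cannot lie on it.  This makes
a geodesic extended by an edge inside its last level a simple path. *)
Lemma geodesic_avoids u v w p : is_upath e u v p -> size p = gdist e u v ->
  v != w -> gdist e u v = gdist e u w -> w \notin u :: p.
Proof.
move=> /and3P[ep _ /eqP lp] sp vw dvw; rewrite inE negb_or; apply/andP; split.
  apply: contraNneq vw => wu.
  have : (size p <= 0)%N by rewrite sp dvw wu; apply: (@gdist_le_path u [::]).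
  by rewrite leqn0 size_eq0 => /eqP p0; rewrite -lp p0 /= wu.
apply/negP => wp; case/splitPr: wp ep lp sp => p1 p2.
rewrite -cat_rcons cat_path last_cat last_rcons size_cat => /andP[ep1 _] lp sp.
have := gdist_le_path ep1; rewrite last_rcons -dvw -sp.
case: p2 lp {sp} => [/= wv|a p2 _]; first by rewrite wv eqxx in vw.
by rewrite /= addnS ltnNge leq_addr.
Qed.

(** Adjacent vertices have distances to u that differ by at most one.  If they
always differed, the parity of the distance would be a 2-colouring. *)
Lemma level_edge u : symmetric e -> connected_graph e -> ~ bipartite_graph e ->
  exists v w, e v w /\ gdist e u v = gdist e u w.
Proof.
move=> es ec nb; apply/not_existsP => H; apply: nb.
exists [set y | odd (gdist e u y)] => x y xy; rewrite !inE.
have xNy : gdist e u x <> gdist e u y by move=> E; apply: (H x); exists y.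
have := gdist_edge (ec u x) xy; have := gdist_edge (ec u y) (etrans (es y x) xy).
case: (ltngtP (gdist e u x) (gdist e u y)) => // lt le1 le2.
  have -> : gdist e u y = (gdist e u x).+1 by apply/eqP; rewrite eqn_leq le2.
  by rewrite /=; case: odd.
have -> : gdist e u x = (gdist e u y).+1 by apply/eqP; rewrite eqn_leq le1.
by rewrite /=; case: odd.
Qed.

End Distance.

(** * Sums along a path *)

Section PathSums.
Variables (R : realFieldType) (T : finType).
Implicit Types (f : T -> T -> R) (x : T -> R) (u : T) (p : seq T).

Definition path_sum f u p : R := \sum_(c <- pairmap f u p) c.

Lemma path_sum_nil f u : path_sum f u [::] = 0.
Proof. exact: big_nil. Qed.

Lemma path_sum_cons f u v p : path_sum f u (v :: p) = f u v + path_sum f v p.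
Proof. exact: big_cons. Qed.

Lemma path_sum_rcons f u p w :
  path_sum f u (rcons p w) = path_sum f u p + f (last u p) w.
Proof.
elim: p u => [|v p IH] u /=; rewrite !(path_sum_cons, path_sum_nil) ?IH ?addrA //.
by rewrite addr0 add0r.
Qed.

(** The signed edge sums x a + x b telescope when the signs alternate. *)
Lemma alternating_telescope x u p :
  `|x u - (-1) ^+ size p * x (last u p)|
    <= path_sum (fun a b => `|x a + x b|) u p.
Proof.
elim: p u => [|v p IH] u /=; first by rewrite path_sum_nil mul1r subrr normr0.
rewrite path_sum_cons exprS.
set c := _ ^+ _; set t := x (last v p).
have -> : x u - -1 * c * t = (x u + x v) - (x v - c * t) by ring.
by apply: (le_trans (ler_normB _ _)); rewrite lerD2l.
Qed.

(** Cauchy-Schwarz for the terms |x a + x b| with weight 1 and |h| with weight 1/2: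
the sum of the squared weights is size p + 1/4. *)
Lemma half_cauchy x u p (h : R) :
  (path_sum (fun a b => `|x a + x b|) u p + h / 2) ^+ 2 <=
  ((size p)%:R + 4^-1) * (path_sum (fun a b => (x a + x b) ^+ 2) u p + h ^+ 2).
Proof.
elim: p u => [|v p IH] u /=; first by rewrite !path_sum_nil; lra.
rewrite !path_sum_cons -[(size p).+1%:R]natr1; move: (IH v) => {IH}.
set a := path_sum _ v p; set q := path_sum _ v p.
rewrite -(real_normK (num_real (x u + x v))).
move: `|_| => c.
set m : R := (size p)%:R + 4^-1; move=> IH.
have m0 : 0 < m by rewrite /m; have := ler0n R (size p); lra.
have -> : (size p)%:R + 1 + 4^-1 = m + 1 by rewrite /m; ring.
rewrite -(ler_pM2l m0) -subr_ge0.
set b := a + h / 2 in IH *; set Q := q + h ^+ 2 in IH *.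
(* After multiplication by m, the difference of the two sides is the induction
   hypothesis times m + 1 plus a square. *)
have -> : m * ((m + 1) * (c ^+ 2 + q + h ^+ 2)) - m * (c + a + h / 2) ^+ 2 =
  (m + 1) * (m * Q - b ^+ 2) + (b - m * c) ^+ 2 by rewrite /b /Q; ring.
by rewrite addr_ge0 ?sqr_ge0 // mulr_ge0 ?subr_ge0 //; lra.
Qed.

(** A simple path meets each unordered pair of vertices at most once, and the double
sum counts each such pair in both orders, hence the factor 2. *)
Lemma path_sum_le_pairs f u p : (forall a b, 0 <= f a b) ->
  (forall a b, f a b = f b a) -> uniq (u :: p) ->
  2 * path_sum f u p <= \sum_a \sum_b f a b.
Proof.
move=> f0 fC up.
have sub (g : T -> R) s : (forall a, 0 <= g a) -> uniq s ->
    \sum_(a <- s) g a <= \sum_a g a.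
  move=> g0 us; rewrite big_uniq // [leRHS](bigID (mem s)) /= lerDl.
  by apply: sumr_ge0.
apply: le_trans (_ : \sum_(a <- u :: p) \sum_(b <- u :: p) f a b <= _); last first.
  apply: le_trans (sub _ _ _ up) _; first by move=> a; apply: sumr_ge0.
  by apply: ler_sum => a _; apply: sub.
elim: p u {up} => [|v p IH] u.
  by rewrite path_sum_nil mulr0 !big_seq1.
rewrite path_sum_cons big_cons; under [X in _ <= _ + X]eq_bigr do rewrite big_cons.
rewrite big_split /= addrA mulrDr; apply: lerD (IH v).
rewrite !big_cons (fC v u).
have h1 : 0 <= \sum_(j <- p) f u j by apply: sumr_ge0.
have h2 : 0 <= \sum_(j <- p) f j u by apply: sumr_ge0.
by have := f0 u u; lra.
Qed.

End PathSums.

(** * The signless Laplacian form *)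

Section SignlessForm.
Variables (R : realFieldType) (T : finType) (e : rel T).
Implicit Type x : T -> R.

(** Twice the quadratic form of the signless Laplacian, since the sum runs over
ordered pairs. *)
Definition signless_form x : R := \sum_a \sum_b (e a b)%:R * (x a + x b) ^+ 2.

Lemma path_sum_le_signless x u p : symmetric e -> path e u p -> uniq (u :: p) ->
  2 * path_sum (fun a b => (x a + x b) ^+ 2) u p <= signless_form x.
Proof.
move=> es ep up.
have -> : path_sum (fun a b => (x a + x b) ^+ 2) u p =
    path_sum (fun a b => (e a b)%:R * (x a + x b) ^+ 2) u p.
  elim: p u ep {up} => [|v p IH] u /=; first by rewrite !path_sum_nil.
  by case/andP=> uv ep; rewrite !path_sum_cons uv mul1r IH.
apply: path_sum_le_pairs up => a b; first by rewrite mulr_ge0 ?sqr_ge0.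
by rewrite es addrC.
Qed.

(** The quantitative form of the fact that, in a connected nonbipartite graph, the
signless Laplacian is positive definite. *)
Lemma signless_form_lower_bound x u : symmetric e -> irreflexive e ->
  connected_graph e -> ~ bipartite_graph e ->
  4 * x u ^+ 2 <= (4 * (diameter e)%:R + 1) * (signless_form x / 2).
Proof.
move=> es ei ec nb.
have [v [w [vw dvw]]] := level_edge u es ec nb.
have [p hp sp] := gdist_path (ec u v).
have [q hq sq] := gdist_path (ec u w).
set S := path_sum (fun a b => `|x a + x b|) u.
have tri : 2 * `|x u| <= S p + S q + `|x v + x w|.
  have := alternating_telescope x u p; have := alternating_telescope x u q.
  rewrite -/(S p) -/(S q) sp sq -dvw.
  have [/and3P[_ _ /eqP->] /and3P[_ _ /eqP->]] := (hp, hq).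
  set c := _ ^+ _ => hw hv.
  have -> : 2 * `|x u| =
      `|(x u - c * x v) + (x u - c * x w) + c * (x v + x w)|.
    by rewrite -[2]ger0_norm // -normrM; congr `|_|; ring.
  apply: le_trans (ler_normD _ _) _; rewrite normrM normrX normrN1 expr1n mul1r.
  by rewrite lerD2r (le_trans (ler_normD _ _)) ?lerD.
(* Both geodesics can contain the same edges; keeping only the heavier one,
   counted twice, leads to a sum over distinct edges. *)
wlog le_qp : v w p q vw dvw hp sp hq sq tri / S q <= S p.
  move=> H; case/orP: (le_total (S q) (S p)); first exact: (H v w p q).
  apply: (H w v q p) => //; first by rewrite es.
  by rewrite [x w + _]addrC [S q + _]addrC.
have w_new : w \notin u :: p.
  by apply: geodesic_avoids hp sp _ dvw; apply: contraTneq vw => ->; rewrite ei.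
have /and3P[ep up /eqP lp] := hp.
have := @path_sum_le_signless x u (rcons p w) es.
rewrite rcons_path ep lp vw -rcons_cons rcons_uniq w_new up => /(_ isT isT).
rewrite path_sum_rcons lp.
have := half_cauchy x u p `|x v + x w|.
rewrite -/(S p) (real_normK (num_real _)) sp.
set E := _ + (x v + x w) ^+ 2 => hC hE.
have xS : `|x u| <= S p + `|x v + x w| / 2 by lra.
have x2 : x u ^+ 2 <= (S p + `|x v + x w| / 2) ^+ 2.
  by rewrite -(real_normK (num_real (x u))) lerXn2r ?nnegrE // (le_trans _ xS).
have dD : (gdist e u v)%:R <= (diameter e)%:R :> R.
  by rewrite ler_nat gdist_diameter.
have d0 := ler0n R (gdist e u v).
have E0 : 0 <= E.
  rewrite addr_ge0 ?sqr_ge0 // /path_sum.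
  elim: (p) (u) => [|a r IH] b /=; first by rewrite big_nil.
  by rewrite big_cons addr_ge0 ?sqr_ge0.
(* The factor 4 d + 1 is four times the weight d + 1/4 of the simple path. *)
have h1 : 4 * x u ^+ 2 <= (4 * (gdist e u v)%:R + 1) * E by lra.
apply: (le_trans h1); apply: ler_pM => //; lra.
Qed.

Lemma signless_form_regular x k :
  symmetric e -> (forall a, #|[set b | e a b]| = k) ->
  signless_form x =
  2 * (k%:R * (\sum_a x a ^+ 2) + \sum_a x a * \sum_b (e a b)%:R * x b).
Proof.
move=> es reg.
have deg a : \sum_b (e a b)%:R = k%:R :> R.
  by rewrite -(reg a) -sum1_card natr_sum [RHS]big_mkcond /=; apply: eq_bigr => b _;
     rewrite inE; case: e.
have sq1 : \sum_a \sum_b (e a b)%:R * x a ^+ 2 = k%:R * \sum_a x a ^+ 2.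
  by rewrite mulr_sumr; apply: eq_bigr => a _; rewrite -mulr_suml deg.
have sq2 : \sum_a \sum_b (e a b)%:R * x b ^+ 2 = k%:R * \sum_a x a ^+ 2.
  rewrite exchange_big -sq1; apply: eq_bigr => a _; apply: eq_bigr => b _.
  by rewrite es.
set M := \sum_a x a ^+ 2 in sq1 sq2 *; set P := \sum_a _ * _.
have -> : 2 * (k%:R * M + P) = k%:R * M + k%:R * M + 2 * P by ring.
rewrite -{1}sq1 -sq2 /P {M P sq1 sq2}.
rewrite [2 * _]mulr_sumr -!big_split /=; apply: eq_bigr => a _.
rewrite mulrA mulr_sumr -!big_split /=; apply: eq_bigr => b _; ring.
Qed.

End SignlessForm.

(** * Eigenvalues of the adjacency matrix *)

Section AdjacencyEigenvalues.
Variables (R : realType) (T : finType) (e : rel T).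
Hypothesis e_sym : symmetric e.

(** Eigenvectors read as functions on the vertices instead of on their ranks; the
symmetry of e turns the row-vector convention into the sum over neighbours. *)
Lemma adjacency_eigenfunction a : eigenvalue (adjacency R e) a ->
  exists2 x : T -> R, (exists t, x t != 0) &
    forall t, \sum_s (e t s)%:R * x s = a * x t.
Proof.
case/eigenvalueP=> v vA v0; exists (fun t => v 0 (enum_rank t)).
  have /rV0Pn[j vj] := v0; exists (enum_val j); by rewrite enum_valK.
move=> t; have /rowP/(_ (enum_rank t)) := vA; rewrite !mxE => <-.
rewrite [RHS](reindex enum_rank) /=; last first.
  by exists enum_val => i _; rewrite ?enum_rankK ?enum_valK.
by apply: eq_bigr => s _; rewrite !mxE !enum_rankK mulrC e_sym.
Qed.

Lemma regular_degree_le_mu_max k : (0 < #|T|)%N ->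
  (forall a, #|[set b | e a b]| = k) -> k%:R <= mu_max R e.
Proof.
move=> T0 reg; have [_] := max_eigenvalueP T0 (adjacency_tr R e_sym); apply.
apply/eigenvalueP; exists (const_mx 1); last first.
  by apply/rV0Pn; exists (Ordinal T0); rewrite mxE oner_neq0.
apply/rowP => j; rewrite !mxE mulr1 -(reg (enum_val j)) -sum1_card natr_sum.
rewrite [RHS]big_mkcond (reindex enum_rank) /=; last first.
  by exists enum_val => i _; rewrite ?enum_rankK ?enum_valK.
by apply: eq_bigr => s _; rewrite !mxE enum_rankK mul1r inE e_sym; case: e.
Qed.

End AdjacencyEigenvalues.

Theorem theorem5 (R : realType) (T : finType) (e : rel T)
    (T_nonempty : (0 < #|T|)%N)
    (e_sym : symmetric e) (e_irr : irreflexive e)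
    (e_connected : connected_graph e)
    (e_regular : regular_graph e)
    (e_nonbipartite : ~ bipartite_graph e) :
  mu_max R e + mu_min R e > 2 / (#|T|%:R * (2 * (diameter e)%:R + 1)).
Proof.
have [k reg] := e_regular.
have kmax := regular_degree_le_mu_max R e_sym T_nonempty reg.
have [emin _] := min_eigenvalueP T_nonempty (adjacency_tr R e_sym).
have [x [t xt] xE] := adjacency_eigenfunction e_sym emin.
rewrite -/(mu_min R e) in xE.
have [u _ umax] := Order.TotalTheory.arg_maxP (i0 := t) (P := xpredT)
  (fun s => x s ^+ 2) isT.
have xu0 : 0 < x u ^+ 2.
  by apply: lt_le_trans (umax t isT); rewrite lt_def sqr_ge0 sqrf_eq0 xt.
have norm_le : \sum_a x a ^+ 2 <= #|T|%:R * x u ^+ 2.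
  rewrite mulr_natl -sumr_const; apply: ler_sum => a _; exact: umax.
have := signless_form_lower_bound x u e_sym e_irr e_connected e_nonbipartite.
rewrite (signless_form_regular x e_sym reg).
have -> : \sum_a x a * \sum_b (e a b)%:R * x b = mu_min R e * \sum_a x a ^+ 2.
  by rewrite mulr_sumr; apply: eq_bigr => a _; rewrite xE; ring.
set N := \sum_a _ in norm_le *; set D : R := (diameter e)%:R.
rewrite -mulrDl [2 * _]mulrC mulfK ?pnatr_eq0 //.
set g := k%:R + _ => bound.
have D0 : 0 <= D by apply: ler0n.
have n0 : 0 < #|T|%:R :> R by rewrite ltr0n.
have N0 : 0 <= N by apply: sumr_ge0 => a _; apply: sqr_ge0.
have g0 : 0 < g.
  have : 0 < (4 * D + 1) * (g * N) by apply: lt_le_trans bound; lra.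
  rewrite pmulr_rgt0; last lra.
  by rewrite !ltNge; apply: contra => g_le0; apply: mulr_le0_ge0.
apply: lt_le_trans (_ : g <= _); last by rewrite /g lerD2r.
rewrite ltr_pdivrMr; last by apply: mulr_gt0 => //; lra.
(* Divide the bound at u by (x u)^2, using that |x| is largest there. *)
have gn : 4 <= (4 * D + 1) * (g * #|T|%:R).
  rewrite -(ler_pM2r xu0); apply: le_trans bound _.
  rewrite -!mulrA ler_pM2l; last lra.
  by rewrite ler_pM2l.
have : 0 < g * #|T|%:R by apply: mulr_gt0.
by rewrite mulrA; move: (g * _) gn => z; lra.
Qed.
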